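(* Let $G=G_n(g,f)$ be a proper Riordan graph with $f'(0)=1$. For $j=0,\ldots,n-1$ let $$\phi_j\equiv[t^j]\frac{tg}{1-f}\quad\text{and}\quad \varphi_j\equiv[t^j]\frac{t\,g(\bar f)\cdot(\bar f)'\cdot(t/\bar f)^{\,n-1}}{1-\bar f}\pmod 2.$$ Then $G$ has an Eulerian trail if and only if either $$\phi_{i-1}+\varphi_{n-i}\equiv 0\pmod 2\quad\text{for all } i=1,\ldots,n, \qquad ( * )$$ or there exist $i_1\ne i_2$ in $\{1,\ldots,n\}$ such that $$\phi_{i-1}+\varphi_{n-i}\equiv\begin{cases}1 & \text{if } i\in\{i_1,i_2\},\\ 0 & \text{if } i\in\{1,\ldots,n\}\setminus\{i_1,i_2\}\end{cases}\pmod 2.$$ In particular, if $( * )$ holds then $G$ is Eulerian.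
   Context: $[t^k]u$ is the coefficient of $t^k$ in $u$. For $g,f\in\mathbb{Z}[[t]]$ with $f(0)=0$, the Riordan graph $G_n(g,f)$ is the simple graph on $[n]=\{1,\dots,n\}$ in which, for $i>j\ge1$, $i$ and $j$ are adjacent iff $[t^{i-2}]\,g f^{\,j-1}\equiv 1 \pmod 2$. It is proper if $g(0)\equiv f'(0)\equiv1\pmod 2$. $\bar f$ denotes the compositional inverse of $f$ and $(\bar f)'$ its derivative. An Eulerian trail is a (closed or open) trail using every edge exactly once; a graph is Eulerian if it has an Eulerian cycle (closed Eulerian trail). *)

(* Defs.v *)
From HB Require Import structures.
From mathcomp Require Import all_boot all_order all_algebra.
From mathcomp Require Import boolp zify.

Set Implicit Arguments.
Unset Strict Implicit.
Unset Printing Implicit Defensive.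

Import GRing.Theory.
Local Open Scope ring_scope.

(* Formal power series R[[t]], as coefficient sequences with a ring structure *)
(* of their own: the product is the Cauchy product, not the pointwise one.    *)
Record fps (R : Type) := Fps { fps_fun : nat -> R }.

Definition fps_coef (R : Type) (k : nat) (u : fps R) : R := fps_fun u k.

Notation "[t^ k ] u" := (fps_coef k u)
  (at level 35, k at level 0, u at level 35, format "[t^ k ]  u") : ring_scope.

Lemma fpsP (R : Type) (u v : fps R) :
  (forall k, [t^k] u = [t^k] v) <-> u = v.
Proof.
split=> [|-> //]; case: u => u; case: v => v uv; congr Fps.
by apply/funext => k; apply: uv.
Qed.

HB.instance Definition _ (R : Type) := gen_eqMixin (fps R).
HB.instance Definition _ (R : Type) := gen_choiceMixin (fps R).

Section FpsRing.
Context {R : comNzRingType}.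
Implicit Types u v w : fps R.

Definition fps_add u v : fps R := Fps (fun k => [t^k] u + [t^k] v).
Definition fps_opp u : fps R := Fps (fun k => - [t^k] u).
Definition fps_mul u v : fps R :=
  Fps (fun k => \sum_(i < k.+1) ([t^i] u) * ([t^(k - i)] v)).
Definition fps_poly (p : {poly R}) : fps R := Fps (fun k => p`_k).

Lemma fps_addA : associative fps_add.
Proof. by move=> u v w; apply/fpsP => k; apply: addrA. Qed.
Lemma fps_addC : commutative fps_add.
Proof. by move=> u v; apply/fpsP => k; apply: addrC. Qed.
Lemma fps_add0 : left_id (fps_poly 0) fps_add.
Proof. by move=> u; apply/fpsP => k; rewrite /fps_coef /= coef0 add0r. Qed.
Lemma fps_addN : left_inverse (fps_poly 0) fps_opp fps_add.
Proof. by move=> u; apply/fpsP => k; rewrite /fps_coef /= coef0 addNr. Qed.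

HB.instance Definition _ := GRing.isZmodule.Build (fps R)
  fps_addA fps_addC fps_add0 fps_addN.

Definition fps_trunc n u : {poly R} := \poly_(i < n) [t^i] u.

Lemma fps_truncE n u i : (i < n)%N -> (fps_trunc n u)`_i = [t^i] u.
Proof. by move=> lt_in; rewrite coef_poly lt_in. Qed.

Lemma fps_mul_trunc n u v i : (i < n)%N ->
  [t^i] (fps_mul u v) = (fps_trunc n u * fps_trunc n v)`_i.
Proof.
move=> lt_in; rewrite coefM; apply: eq_bigr => j _.
by rewrite !fps_truncE // (leq_ltn_trans _ lt_in) ?leq_subr // -ltnS.
Qed.

Lemma fps_mulA : associative fps_mul.
Proof.
move=> u v w; apply/fpsP => k; have E := @fps_mul_trunc k.+1.
transitivity ((fps_trunc k.+1 u * (fps_trunc k.+1 v * fps_trunc k.+1 w))`_k).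
  rewrite (E u) // !coefM; apply: eq_bigr => i _; congr (_ * _).
  by rewrite fps_truncE ?E // ltnS leq_subr.
rewrite mulrA (E _ w) // [RHS]coefM [LHS]coefM.
by apply: eq_bigr => i _; rewrite [in RHS]fps_truncE ?E.
Qed.
Lemma fps_mulC : commutative fps_mul.
Proof.
by move=> u v; apply/fpsP => k; rewrite !(@fps_mul_trunc k.+1) // mulrC.
Qed.
Lemma fps_mul1 : left_id (fps_poly 1) fps_mul.
Proof.
move=> u; apply/fpsP => k; rewrite {1}/fps_coef /= big_ord_recl /=.
rewrite {1}/fps_coef /= coef1 mul1r subn0 big1 ?addr0 // => i _.
by rewrite {1}/fps_coef /= coef1 mul0r.
Qed.
Lemma fps_mulD : left_distributive fps_mul fps_add.
Proof.
move=> u v w; apply/fpsP => k; rewrite /fps_coef /= -big_split /=.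
by apply: eq_bigr => i _; rewrite mulrDl.
Qed.
Lemma fps_1neq0 : fps_poly 1 != fps_poly 0.
Proof.
apply/eqP => /fpsP/(_ 0%N); rewrite /fps_coef /= coef1 coef0.
by move/eqP; rewrite oner_eq0.
Qed.

HB.instance Definition _ := GRing.Zmodule_isComNzRing.Build (fps R)
  fps_mulA fps_mulC fps_mul1 fps_mulD fps_1neq0.

Definition fps_X : fps R := fps_poly 'X.

Lemma fps_coefD k u v : [t^k] (u + v) = [t^k] u + [t^k] v.
Proof. by []. Qed.
Lemma fps_coefN k u : [t^k] (- u) = - [t^k] u.
Proof. by []. Qed.
Lemma fps_coefB k u v : [t^k] (u - v) = [t^k] u - [t^k] v.
Proof. by []. Qed.
Lemma fps_coefM k u v :
  [t^k] (u * v) = \sum_(i < k.+1) ([t^i] u) * ([t^(k - i)] v).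
Proof. by []. Qed.
Lemma fps_coef_poly k (p : {poly R}) : [t^k] (fps_poly p) = p`_k.
Proof. by []. Qed.
Lemma fps_coef0 k : [t^k] (0 : fps R) = 0.
Proof. by rewrite fps_coef_poly coef0. Qed.
Lemma fps_coef1 k : [t^k] (1 : fps R) = (k == 0%N)%:R.
Proof. by rewrite fps_coef_poly coef1. Qed.
Lemma fps_coefX k : [t^k] fps_X = (k == 1%N)%:R.
Proof. by rewrite fps_coef_poly coefX. Qed.
Lemma fps_coef0M u v : [t^0] (u * v) = [t^0] u * [t^0] v.
Proof. by rewrite fps_coefM big_ord1. Qed.

Lemma fps_polyB : zmod_morphism fps_poly.
Proof. by move=> p q; apply/fpsP => k; rewrite fps_coefB !fps_coef_poly coefB. Qed.
Lemma fps_polyM : monoid_morphism fps_poly.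
Proof.
by split=> // p q; apply/fpsP => k; rewrite fps_coefM !fps_coef_poly coefM.
Qed.
HB.instance Definition _ := GRing.isZmodMorphism.Build {poly R} (fps R) fps_poly
  fps_polyB.
HB.instance Definition _ := GRing.isMonoidMorphism.Build {poly R} (fps R) fps_poly
  fps_polyM.

Lemma fps_polyXn (p : {poly R}) m : fps_poly (p ^+ m) = fps_poly p ^+ m.
Proof. exact: (rmorphXn fps_poly). Qed.

Definition fps_eqmod n u v := forall i, (i < n)%N -> [t^i] u = [t^i] v.

Lemma fps_eqmod_trunc n u : fps_eqmod n u (fps_poly (fps_trunc n u)).
Proof. by move=> i lt_in; rewrite fps_coef_poly fps_truncE. Qed.

Lemma fps_eqmodM n u u' v v' :
  fps_eqmod n u u' -> fps_eqmod n v v' -> fps_eqmod n (u * v) (u' * v').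
Proof.
move=> uu' vv' i lt_in; rewrite !fps_coefM; apply: eq_bigr => j _.
by rewrite uu' ?vv' // (leq_ltn_trans _ lt_in) ?leq_subr // -ltnS.
Qed.

Lemma fps_eqmodX n u v m :
  fps_eqmod n u v -> fps_eqmod n (u ^+ m) (v ^+ m).
Proof.
move=> uv; elim: m => [|m IHm]; first by rewrite !expr0.
by rewrite !exprS; apply: fps_eqmodM.
Qed.

Lemma fps_coef_exp_small u m k : [t^0] u = 0 -> (k < m)%N -> [t^k] (u ^+ m) = 0.
Proof.
move=> u0; elim: m k => // m IHm k lt_km; rewrite exprS fps_coefM.
rewrite big_ord_recl /= u0 mul0r add0r big1 // => i _.
rewrite IHm ?mulr0 // /bump /= add1n; case: k lt_km i => [|k] lt_km [i lt_ik] //=.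
by rewrite subSS (leq_ltn_trans (leq_subr _ _)).
Qed.

(* Composition u(v), meaningful when v(0) = 0: then [t^k] v^i = 0 for i > k,  *)
(* so the sum below is the coefficient of the infinite sum over all i.        *)
Definition fps_comp u v : fps R :=
  Fps (fun k => \sum_(i < k.+1) ([t^i] u) * ([t^k] (v ^+ i))).

Definition fps_deriv u : fps R := Fps (fun k => ([t^(k.+1)] u) *+ k.+1).

Lemma fps_coef_comp k u v :
  [t^k] (fps_comp u v) = \sum_(i < k.+1) ([t^i] u) * ([t^k] (v ^+ i)).
Proof. by []. Qed.

Lemma fps_coef0_comp u v : [t^0] (fps_comp u v) = [t^0] u.
Proof. by rewrite fps_coef_comp big_ord1 expr0 fps_coef1 mulr1. Qed.

Lemma fps_coef_compS k u v :
  [t^(k.+1)] (fps_comp u v) = ([t^1] u) * ([t^(k.+1)] v) +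
    \sum_(i < k) ([t^(i.+2)] u) * ([t^(k.+1)] (v ^+ i.+2)).
Proof.
rewrite fps_coef_comp 2!big_ord_recl expr0 expr1 fps_coef1 mulr0 add0r.
by congr (_ + _); apply: eq_bigr.
Qed.

Lemma fps_eqmod_comp n u u' v v' :
  fps_eqmod n u u' -> fps_eqmod n v v' ->
  fps_eqmod n (fps_comp u v) (fps_comp u' v').
Proof.
move=> uu' vv' i lt_in; rewrite !fps_coef_comp; apply: eq_bigr => j _.
rewrite (fps_eqmodX j vv') // uu' // (leq_ltn_trans _ lt_in) // -ltnS //.
Qed.

Lemma fps_comp_poly (p q : {poly R}) : q`_0 = 0 ->
  fps_comp (fps_poly p) (fps_poly q) = fps_poly (p \Po q).
Proof.
move=> q0; apply/fpsP => k; rewrite fps_coef_comp fps_coef_poly coef_comp_poly.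
under eq_bigr do rewrite -fps_polyXn !fps_coef_poly.
pose F i := p`_i * (q ^+ i)`_k; pose N := maxn k.+1 (size p).
rewrite (big_ord_widen N F) ?leq_maxl // (big_ord_widen N F) ?leq_maxr //.
rewrite big_mkcond [RHS]big_mkcond; apply: eq_bigr => i _ /=.
have F1 : (k < i)%N -> F i = 0.
  by move=> ?; rewrite /F -(fps_coef_poly k) fps_polyXn fps_coef_exp_small ?mulr0.
have F2 : (size p <= i)%N -> F i = 0 by move=> ?; rewrite /F nth_default ?mul0r.
rewrite ltnS; case: leqP => [le_pi|_]; case: leqP => [_|lt_ki] //.
- exact: F2.
- by rewrite F1.
Qed.

Lemma fps_trunc0 n u : [t^0] u = 0 -> (fps_trunc n u)`_0 = 0.
Proof. by move=> u0; rewrite coef_poly u0 if_same. Qed.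

Lemma fps_comp_trunc n u v : [t^0] v = 0 ->
  fps_eqmod n (fps_comp u v) (fps_poly (fps_trunc n u \Po fps_trunc n v)).
Proof.
move=> v0; rewrite -fps_comp_poly ?fps_trunc0 //.
by apply: fps_eqmod_comp; apply: fps_eqmod_trunc.
Qed.

Lemma fps_compM u v w : [t^0] w = 0 ->
  fps_comp (u * v) w = fps_comp u w * fps_comp v w.
Proof.
move=> w0; apply/fpsP => k; pose T := fps_trunc k.+1.
transitivity ([t^k] (fps_poly ((T u * T v) \Po T w))).
  rewrite -fps_comp_poly ?fps_trunc0 //; apply: (@fps_eqmod_comp k.+1) => //.
    by rewrite rmorphM; apply: fps_eqmodM; apply: fps_eqmod_trunc.
  exact: fps_eqmod_trunc.
rewrite comp_polyM rmorphM; apply/esym/(@fps_eqmodM k.+1) => //;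
  exact: fps_comp_trunc.
Qed.

Lemma fps_compB u v w : fps_comp (u - v) w = fps_comp u w - fps_comp v w.
Proof.
apply/fpsP => k; rewrite fps_coefB !fps_coef_comp -sumrB.
by apply: eq_bigr => i _; rewrite mulrBl.
Qed.

Lemma fps_comp1 w : fps_comp 1 w = 1.
Proof.
apply/fpsP => k; rewrite fps_coef_comp big_ord_recl expr0 fps_coef1 mul1r.
by rewrite big1 ?addr0 // => i _; rewrite fps_coef1 mul0r.
Qed.

Lemma fps_compX w : [t^0] w = 0 -> fps_comp fps_X w = w.
Proof.
move=> w0; apply/fpsP => -[|k]; first by rewrite fps_coef0_comp fps_coefX w0.
rewrite fps_coef_comp 2!big_ord_recl !fps_coefX mul0r add0r mul1r expr1.
by rewrite big1 ?addr0 // => i _; rewrite fps_coefX mul0r.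
Qed.

Lemma fps_comp_X u : fps_comp u fps_X = u.
Proof.
apply/fpsP => k; rewrite fps_coef_comp big_ord_recr /= big1 => [|i _].
  by rewrite add0r /fps_X -fps_polyXn fps_coef_poly coefXn eqxx mulr1.
by rewrite /fps_X -fps_polyXn fps_coef_poly coefXn gtn_eqF ?mulr0.
Qed.

Lemma fps_compA u v w : [t^0] v = 0 -> [t^0] w = 0 ->
  fps_comp u (fps_comp v w) = fps_comp (fps_comp u v) w.
Proof.
move=> v0 w0; apply/fpsP => k; pose T := fps_trunc k.+1.
have T0 x : [t^0] x = 0 -> (T x)`_0 = 0 by exact: fps_trunc0.
have TE x : fps_eqmod k.+1 x (fps_poly (T x)) by exact: fps_eqmod_trunc.
transitivity ([t^k] (fps_poly (T u \Po (T v \Po T w)))).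
  rewrite -fps_comp_poly; last first.
    rewrite -fps_coef_poly -fps_comp_poly ?T0 // fps_coef0_comp fps_coef_poly.
    exact: T0.
  by apply: (@fps_eqmod_comp k.+1) => //; apply: fps_comp_trunc.
rewrite comp_polyA -fps_comp_poly ?T0 //; apply/esym.
by apply: (@fps_eqmod_comp k.+1) => //; apply: fps_comp_trunc.
Qed.

End FpsRing.

Arguments fps_X {R}.

Section FpsUnit.
Context {R : comUnitRingType}.
Implicit Types u v w : fps R.

Definition fps_unit : {pred fps R} := fun u => [t^0] u \is a GRing.unit.

(* With c = u(0), 1/u = c^-1 * (1 + w + w^2 + ...) for w = 1 - c^-1 u.        *)
Definition fps_inv u : fps R :=
  if fps_unit u then
    let c := fps_poly ([t^0] u)^-1%:P in
    c * fps_comp (Fps (fun=> 1)) (1 - c * u)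
  else u.

Lemma fps_geom : (Fps (fun=> 1) : fps R) * (1 - fps_X) = 1.
Proof.
apply/fpsP => k; rewrite mulrBr mulr1 fps_coefB mulrC fps_coefM fps_coef1.
case: k => [|k]; first by rewrite big_ord1 fps_coefX mul0r subr0.
rewrite 2!big_ord_recl !fps_coefX mul0r add0r mul1r big1.
  by rewrite addr0 subrr.
by move=> i _; rewrite fps_coefX mul0r.
Qed.

Lemma fps_mulVr : {in fps_unit, left_inverse 1 fps_inv *%R}.
Proof.
move=> u uU; rewrite /fps_inv ifT //; set c := fps_poly _; set w := 1 - c * u.
have w0 : [t^0] w = 0.
  rewrite fps_coefB fps_coef1 fps_coef0M fps_coef_poly coefC /= mulVr ?subrr //.
rewrite mulrAC mulrC; have -> : c * u = fps_comp (1 - fps_X) w.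
  by rewrite fps_compB fps_comp1 fps_compX // /w subKr.
by rewrite -fps_compM // fps_geom fps_comp1.
Qed.

Lemma fps_intro_unit u v : v * u = 1 -> fps_unit u.
Proof.
move/fpsP/(_ 0%N); rewrite fps_coef0M fps_coef1 mulrC => uv1.
by apply/unitrP; exists ([t^0] v); rewrite mulrC uv1.
Qed.

Lemma fps_inv_out : {in [predC fps_unit], fps_inv =1 id}.
Proof. by move=> u; rewrite inE /= => /negbTE uU; rewrite /fps_inv ifF. Qed.

HB.instance Definition _ := GRing.ComNzRing_hasMulInverse.Build (fps R)
  fps_mulVr fps_intro_unit fps_inv_out.

Lemma fps_unitE u : (u \is a GRing.unit) = ([t^0] u \is a GRing.unit).
Proof. by []. Qed.

Definition fps_divX u : fps R := Fps (fun k => [t^(k.+1)] u).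

Lemma fps_divXK u : [t^0] u = 0 -> fps_X * fps_divX u = u.
Proof.
move=> u0; apply/fpsP => -[|k]; first by rewrite fps_coef0M fps_coefX mul0r u0.
rewrite fps_coefM 2!big_ord_recl !fps_coefX mul0r add0r mul1r big1 => [|i _].
  by rewrite addr0 /= subn1.
by rewrite fps_coefX mul0r.
Qed.

(* t/u for u(0) = 0 and u'(0) invertible, a series although u is not a unit.  *)
Definition fps_Xdiv u : fps R := (fps_divX u)^-1.

Lemma fps_XdivK u : [t^0] u = 0 -> [t^1] u \is a GRing.unit ->
  u * fps_Xdiv u = fps_X.
Proof. by move=> u0 u1; rewrite -{1}(fps_divXK u0) mulrK. Qed.

(* The compositional inverse of f, for f(0) = 0 and f'(0) invertible, is the  *)
(* coefficientwise limit of h_(m+1) = h_m - f'(0)^-1 (f(h_m) - t).            *)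
Definition fps_rev_approx (f : fps R) (m : nat) : fps R :=
  iter m (fun h => h - fps_poly ([t^1] f)^-1%:P * (fps_comp f h - fps_X)) 0.

Definition fps_rev (f : fps R) : fps R :=
  Fps (fun k => [t^k] (fps_rev_approx f k)).

Lemma fps_coefCM k (c : R) u : [t^k] (fps_poly c%:P * u) = c * [t^k] u.
Proof.
rewrite fps_coefM big_ord_recl big1 => [|i _].
  by rewrite fps_coef_poly coefC /= subn0 addr0.
by rewrite fps_coef_poly coefC mul0r.
Qed.

Lemma fps_eqmodMS n u u' v v' : [t^0] u = 0 -> [t^0] u' = 0 ->
  [t^0] v = 0 -> [t^0] v' = 0 -> fps_eqmod n u u' -> fps_eqmod n v v' ->
  fps_eqmod n.+1 (u * v) (u' * v').
Proof.
move=> u0 u'0 v0 v'0 uu' vv' i; rewrite ltnS => le_in.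
rewrite !fps_coefM; apply: eq_bigr => -[[|j] ltj] _ /=; first by rewrite u0 u'0 !mul0r.
rewrite ltnS in ltj; rewrite vv'; last by lia.
have [eq_ji|] := eqVneq j.+1 i; first by rewrite eq_ji subnn v'0 !mulr0.
by move=> ne_ji; rewrite uu' //; lia.
Qed.

Section Reversion.
Variable f : fps R.
Hypotheses (f0 : [t^0] f = 0) (f1 : [t^1] f \is a GRing.unit).

Let h := fps_rev_approx f.

Lemma fps_rev_approx0 m : [t^0] (h m) = 0.
Proof.
elim: m => [|m IHm]; first by rewrite fps_coef0.
rewrite [h _]iterS -/(fps_rev_approx f m) -/h fps_coefB fps_coefCM fps_coefB.
by rewrite fps_coef0_comp fps_coefX f0 IHm subr0 mulr0 subr0.
Qed.

Lemma fps_rev_approxP m : fps_eqmod m.+1 (fps_comp f (h m)) fps_X.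
Proof.
elim: m => [|m IHm].
  by case=> // _; rewrite fps_coef0_comp fps_coefX f0.
have hS : h m.+1 = h m - fps_poly ([t^1] f)^-1%:P * (fps_comp f (h m) - fps_X) by [].
have H0 := fps_rev_approx0 m.+1; have h0 := fps_rev_approx0 m.
move: (h m.+1) H0 hS => H H0 hS.
have eq_h : fps_eqmod m.+1 H (h m).
  by move=> i lt_im; rewrite hS fps_coefB fps_coefCM fps_coefB IHm // subrr mulr0 subr0.
have eq_hX j : fps_eqmod m.+2 (H ^+ j.+2) (h m ^+ j.+2).
  rewrite !(exprS _ j.+1); apply: fps_eqmodMS => //.
  - by rewrite fps_coef_exp_small.
  - by rewrite fps_coef_exp_small.
  - exact: fps_eqmodX.
have E i : (i < m.+2)%N -> [t^i] (fps_comp f H) =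
    [t^i] (fps_comp f (h m)) + [t^1] f * ([t^i] H - [t^i] (h m)).
  case: i => [|i] lt_im.
    by rewrite !fps_coef0_comp H0 h0 subrr mulr0 addr0.
  rewrite !fps_coef_compS mulrBr [RHS]addrC addrA subrK; congr (_ + _).
  by apply: eq_bigr => j _; rewrite eq_hX.
move=> i lt_im; rewrite E // {1}hS fps_coefB fps_coefCM fps_coefB.
by rewrite addrAC subrr add0r mulrN mulVKr // opprB addrC subrK.
Qed.

Lemma fps_rev_approx_rev m : fps_eqmod m.+1 (fps_rev f) (h m).
Proof.
move=> i; rewrite ltnS => /subnKC <-; elim: (m - i)%N => [|d IHd]; first by rewrite addn0.
rewrite addnS IHd [in RHS]/h /fps_rev_approx iterS -/(fps_rev_approx f _) -/h.
rewrite fps_coefB fps_coefCM fps_coefB fps_rev_approxP ?subrr ?mulr0 ?subr0 //.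
by rewrite ltnS leq_addr.
Qed.

Lemma fps_coef0_rev : [t^0] (fps_rev f) = 0.
Proof. exact: fps_coef0. Qed.

Lemma fps_coef1_rev : [t^1] (fps_rev f) = ([t^1] f)^-1.
Proof.
rewrite (fps_rev_approx_rev (ltnSn 1)) fps_coefB fps_coefCM fps_coefB fps_coef0.
rewrite fps_coef_comp !big_ord_recl big_ord0 expr0 expr1 fps_coef1 fps_coef0.
by rewrite fps_coefX !mulr0 !addr0 !sub0r mulrN opprK mulr1.
Qed.

Lemma fps_comp_rev : fps_comp f (fps_rev f) = fps_X.
Proof.
apply/fpsP => k; rewrite -(@fps_rev_approxP k k) //.
by apply: (@fps_eqmod_comp _ k.+1) => //; apply: fps_rev_approx_rev.
Qed.

End Reversion.

Lemma fps_rev_comp (f : fps R) : [t^0] f = 0 -> [t^1] f \is a GRing.unit ->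
  fps_comp (fps_rev f) f = fps_X.
Proof.
move=> f0 f1; set h := fps_rev f.
have h0 : [t^0] h = 0 by apply: fps_coef0_rev.
have h1 : [t^1] h \is a GRing.unit by rewrite fps_coef1_rev // unitrV.
have k0 : [t^0] (fps_rev h) = 0 by apply: fps_coef0_rev.
have <- : fps_comp h (fps_rev h) = fps_X by apply: fps_comp_rev.
congr (fps_comp h _); rewrite -[LHS]fps_comp_X -(fps_comp_rev h0 h1).
by rewrite fps_compA // fps_comp_rev // fps_compX.
Qed.

Lemma fps_rev_unique (f h : fps R) : [t^0] f = 0 -> [t^1] f \is a GRing.unit ->
  [t^0] h = 0 -> fps_comp f h = fps_X -> h = fps_rev f.
Proof.
move=> f0 f1 h0 fh; rewrite -[RHS]fps_comp_X -fh fps_compA //.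
by rewrite fps_rev_comp // fps_compX.
Qed.

End FpsUnit.

Section Trails.
Variables (T : finType) (e : rel T).
Implicit Types (x : T) (p : seq T).

Definition edge_set : {set {set T}} :=
  [set E | [exists u, exists v, e u v && (E == [set u; v])]].

Definition trail_edges x p : seq {set T} := pairmap (fun u v => [set u; v]) x p.

(* The walk x :: p, from x to last x p; p = [::] is allowed.                  *)
Definition trail x p : bool := path e x p && uniq (trail_edges x p).

Definition eulerian_trail x p : Prop :=
  trail x p /\
  {in edge_set, forall E : {set T}, count_mem E (trail_edges x p) = 1%N}.

Definition has_eulerian_trail : Prop := exists x p, eulerian_trail x p.

Definition eulerian : Prop := exists x p, eulerian_trail x p /\ last x p = x.

End Trails.

Definition riordan_proper (g f : fps int) : Prop :=
  ([t^0] g = 1 %[mod 2])%Z /\ ([t^0] (fps_deriv f) = 1 %[mod 2])%Z.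

Definition riordan_entry (g f : fps int) (i j : nat) : bool :=
  ([t^(i - 2)] (g * f ^+ (j - 1)) == 1 %[mod 2])%Z.

(* The vertex x : 'I_n carries the label x.+1 in {1, ..., n}.                 *)
Definition riordan_graph (n : nat) (g f : fps int) : rel 'I_n :=
  fun x y => let i := x.+1 in let j := y.+1 in
    if (j < i)%N then riordan_entry g f i j
    else (i < j)%N && riordan_entry g f j i.

Arguments riordan_graph : clear implicits.

Lemma riordan_graph_sym n g f : symmetric (riordan_graph n g f).
Proof. by move=> x y; rewrite /riordan_graph /= !ltnS; case: ltngtP. Qed.

Lemma riordan_graph_irr n g f : irreflexive (riordan_graph n g f).
Proof. by move=> x; rewrite /riordan_graph /= ltnn. Qed.

(* Main.v *)
Require Import Defs.
From mathcomp Require Import all_boot all_order all_algebra.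
From mathcomp Require Import zify ring.
Import GRing.Theory.
Set Implicit Arguments.
Unset Strict Implicit.
Unset Printing Implicit Defensive.

(** The numbers $\phi_{i-1}$ and $\varphi_{n-i}$ are, modulo 2, the numbers of
    neighbours of the vertex i below and above i, so the statement is Euler's
    theorem for G.

    Below: the neighbours j < i are counted, modulo 2, by the sum of
    [t^(i-2)] g f^(j-1) over j < i. As f(0) = 0, the powers f^(j-1) with j >= i do not reach
    degree i-2, so this is [t^(i-2)] of the full geometric sum g / (1 - f)
    (riordan_row_sum).

    Above: the neighbours k > i are counted, modulo 2, by the sum of
    [t^(k-2)] g f^(i-1) over k <= n, which is [u^(n-2)] F(u) for F = g f^(i-1) / (1 - u). Seen as
    the residue of F(u) u^-(n-1) du, it can be computed after substituting
    u = h(t), with h the compositional inverse of f; since f(h) = t, the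
    result is $\varphi_{n-i}$ (riordan_column_sum). The substitution rule for
    residues (fps_change_variable) is proved without Laurent series: by
    linearity it reduces to powers of u, and there it says that the
    derivative of a power of h has no residue (residue_power).

    Euler's theorem (eulerian_trailP): G is connected because properness makes
    consecutive labels adjacent (riordan_connected). Along a trail from a to b
    every vertex is met by an even number of edges, up to one for each
    end, so a trail using all edges forces the parities of the degrees.
    Conversely, a trail that has these parities leaves a graph with even
    degrees only; if an edge is left, then one is left at a vertex v of the
    trail, a trail from v that cannot be prolonged in the remaining graph
    returns to v, and it can be spliced in (eulerian_extension). *)

(** * Eulerian trails in connected graphs *)

Section Euler.
Variable T : finType.
Implicit Types (e : rel T) (x y u v w : T) (p q : seq T) (E : {set T}).

Definition incident e v : {set {set T}} := [set E in edge_set e | v \in E].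

Lemma edge_setP e E :
  reflect (exists u v, e u v /\ E = [set u; v]) (E \in edge_set e).
Proof.
rewrite inE; apply: (iffP existsP) => [[u /existsP[v /andP[uv /eqP->]]]|].
  by exists u, v.
by case=> u [v [uv ->]]; exists u; apply/existsP; exists v; rewrite uv eqxx.
Qed.

Lemma in_incident e v E : (E \in incident e v) = (E \in edge_set e) && (v \in E).
Proof. by rewrite in_set. Qed.

Lemma mem_edge_set e u v : e u v -> [set u; v] \in edge_set e.
Proof. by move=> uv; apply/edge_setP; exists u, v. Qed.

(** The degree of v counted by edges equals the degree counted by neighbours;
    edges are the convenient side for trails, neighbours for the adjacency
    rule of the graph. *)
Lemma card_incident e v : symmetric e -> irreflexive e ->
  #|incident e v| = \sum_w e v w.
Proof.
move=> sym irr; rewrite -big_mkcond sum1_card -(@card_in_imset _ _ (fun w => [set v; w])).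
  apply: eq_card => E; apply/idP/imsetP; last first.
    by case=> w vw ->; rewrite inE mem_edge_set // set21.
  rewrite inE => /andP[/edge_setP[u [w [uw ->]]]]; rewrite !inE.
  case/orP=> /eqP->; first by exists w.
  by exists u; [rewrite unfold_in sym | rewrite setUC].
move=> w w' vw vw' /setP/(_ w); rewrite !inE eqxx orbT.
case: eqP => [eq_wv|_ /esym/eqP //]; move: vw; rewrite unfold_in eq_wv irr //.
Qed.

Lemma trail_edges_cat x p q :
  trail_edges x (p ++ q) = trail_edges x p ++ trail_edges (last x p) q.
Proof. exact: pairmap_cat. Qed.

Lemma trail_edges_sub e x p : path e x p -> {subset trail_edges x p <= edge_set e}.
Proof.
elim: p x => //= y p IHp x /andP[xy yp] E; rewrite inE => /orP[/eqP->|].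
  exact: mem_edge_set.
exact: IHp.
Qed.

Lemma trail_edges_vertices x p E v : E \in trail_edges x p -> v \in E -> v \in x :: p.
Proof.
elim: p x => //= y p IHp x; rewrite inE => /orP[/eqP->|/IHp yE /yE yp].
  by rewrite !inE => /orP[]/eqP->; rewrite eqxx ?orbT.
by rewrite inE yp orbT.
Qed.

(** Every passage of the trail through v uses two edges at v; only a start or
    an end at v contributes one. *)
Lemma odd_trail_incidence e x p v : irreflexive e -> path e x p ->
  odd (count (fun E => v \in E) (trail_edges x p)) = (v == x) (+) (v == last x p).
Proof.
move=> irr; elim: p x => [|y p IHp] x /=; first by rewrite addbb.
case/andP=> xy /IHp; rewrite oddD => ->; rewrite !inE.
have [->|nvx] := eqVneq v x; last by case: (v == y); case: (v == _).
by have [eq_xy|] := eqVneq x y; [rewrite -eq_xy irr in xy|].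
Qed.

Lemma count_incident e x p v : trail e x p ->
  count (fun E => v \in E) (trail_edges x p)
    = #|[set E in incident e v | E \in trail_edges x p]|.
Proof.
case/andP=> xp up; rewrite -size_filter -(card_uniqP _) ?filter_uniq //.
apply: eq_card => E; rewrite !inE mem_filter andbC.
case: (boolP (E \in trail_edges x p)) => [/(trail_edges_sub xp)|]; last by rewrite !andbF.
by rewrite inE => ->; rewrite !andbT.
Qed.

Lemma trail_size e x p : trail e x p -> size p <= #|edge_set e|.
Proof.
case/andP=> xp up; rewrite -(size_pairmap (fun u v => [set u; v]) x p).
rewrite -/(trail_edges x p) -(card_uniqP up); apply/subset_leq_card/subsetP.
exact: trail_edges_sub.
Qed.

Lemma trail_rcons e x p w : trail e x p -> e (last x p) w ->
  [set last x p; w] \notin trail_edges x p -> trail e x (rcons p w).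
Proof.
case/andP=> xp up pw new; rewrite /trail rcons_path xp pw /=.
by rewrite -cats1 trail_edges_cat cats1 rcons_uniq new.
Qed.

(** Trails have at most as many steps as there are edges, so prolonging the
    empty trail at x stops. *)
Lemma stuck_trail e x : exists p, trail e x p /\
  (forall w, e (last x p) w -> [set last x p; w] \in trail_edges x p).
Proof.
suff: forall m p, trail e x p -> #|edge_set e| - size p <= m -> exists p,
    trail e x p /\ (forall w, e (last x p) w -> [set last x p; w] \in trail_edges x p).
  by move/(_ _ [::]); apply=> //.
elim=> [|m IHm] p tp le_m.
(* m bounds the number of edges left; for m = 0 a further step would exceed
   the number of edges. *)
all: case: (boolP [forall w, e (last x p) w ==> ([set last x p; w] \in trail_edges x p)]).
all: try by move/forallP=> stuck; exists p; split=> // w; apply/implyP.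
all: case/forallPn=> w; rewrite negb_imply => /andP[pw new].
all: have tq := trail_rcons tp pw new; have := trail_size tq; rewrite size_rcons => lt_p.
  by lia.
by apply: IHm tq _; rewrite size_rcons; lia.
Qed.

(** At the end of a trail that cannot be prolonged all edges are used, so the
    parity of the degree there is read off the trail itself. *)
Lemma odd_stuck e x p : symmetric e -> irreflexive e -> trail e x p ->
  (forall w, e (last x p) w -> [set last x p; w] \in trail_edges x p) ->
  odd #|incident e (last x p)| = (last x p != x).
Proof.
move=> sym irr tp stuck; have /andP[xp _] := tp.
have := odd_trail_incidence (last x p) irr xp; rewrite (count_incident _ tp) eqxx addbT => <-.
congr (odd _); apply: eq_card => E; rewrite [RHS]inE.
case: (boolP (E \in incident _ _)) => //=; rewrite inE => /andP[/edge_setP[u [w [uw ->]]]].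
rewrite !inE => /orP[] /eqP last_uw; apply/esym.
  by rewrite -last_uw stuck // last_uw.
by rewrite setUC -last_uw stuck // last_uw sym.
Qed.

Definition residual e x p : rel T :=
  fun u v => e u v && ([set u; v] \notin trail_edges x p).

Lemma residual_sym e x p : symmetric e -> symmetric (residual e x p).
Proof. by move=> sym u v; rewrite /residual sym setUC. Qed.

Lemma residual_irr e x p : irreflexive e -> irreflexive (residual e x p).
Proof. by move=> irr u; rewrite /residual irr. Qed.

Lemma edge_set_residual e x p E :
  (E \in edge_set (residual e x p)) = (E \in edge_set e) && (E \notin trail_edges x p).
Proof.
apply/edge_setP/andP=> [[u [v [/andP[uv new] ->]]]|[/edge_setP[u [v [uv ->]]] new]].
  by split=> //; apply: mem_edge_set.
by exists u, v; split=> //; apply/andP.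
Qed.

Lemma odd_residual e x p v : irreflexive e -> trail e x p ->
  odd #|incident (residual e x p) v|
    = odd #|incident e v| (+) ((v == x) (+) (v == last x p)).
Proof.
move=> irr tp; have /andP[xp _] := tp.
rewrite -(odd_trail_incidence v irr xp) (count_incident v tp).
rewrite -(cardsID [set E in trail_edges x p] (incident e v)) oddD addbC addbA.
have -> : #|[set E in incident e v | E \in trail_edges x p]|
    = #|incident e v :&: [set E in trail_edges x p]|.
  by apply: eq_card => E; rewrite !inE.
rewrite addbb; congr (odd _); apply: eq_card => E.
rewrite in_setD !in_incident edge_set_residual [_ \in [set _ in _]]in_set.
by rewrite andbAC andbC.
Qed.

(** If no edge were left at the vertices of the trail, these vertices would
    form a set closed under adjacency, hence everything by connectedness, and
    the unused edge E would itself be left at one of them. *)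
Lemma unused_at_vertex e x p E : (forall u v, connect e u v) -> symmetric e ->
  E \in edge_set e -> E \notin trail_edges x p ->
  exists v w, v \in x :: p /\ residual e x p v w.
Proof.
move=> conn sym /edge_setP[u [w [uw ->]]] new.
case: (boolP [exists v in x :: p, exists w, residual e x p v w]) => [|none].
  by case/exists_inP=> v vp /existsP[w' ?]; exists v, w'.
have stays v v' : e v v' -> v \in x :: p -> v' \in x :: p.
  move=> vv' vp; apply: (@trail_edges_vertices _ _ [set v; v']); last exact: set22.
  apply: contraR none => new'; apply/exists_inP; exists v => //.
  by apply/existsP; exists v'; apply/andP.
have up : u \in x :: p.
  rewrite -(@closed_connect _ e (mem (x :: p)) _ x u) ?conn ?mem_head //.
  apply: intro_closed stays; exact: sym_connect_sym.
by exists u, w; split=> //; apply/andP.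
Qed.

(** The parity hypothesis says that removing the edges of the trail leaves
    only even degrees, which is what makes a stuck trail in the remaining
    graph closed. *)
Lemma eulerian_extension e x p : (forall u v, connect e u v) ->
  symmetric e -> irreflexive e -> trail e x p ->
  (forall v, odd #|incident e v| = (v == x) (+) (v == last x p)) ->
  exists q, eulerian_trail e x q /\ last x q = last x p.
Proof.
move=> conn sym irr; have [m] := ubnP (#|edge_set e| - size p).
elim: m p => // m IHm p lt_m tp par.
case: (boolP [forall E in edge_set e, E \in trail_edges x p]) => [/forall_inP all_p|].
  exists p; split=> //; split=> // E /all_p Ep.
  by case/andP: tp => _ up; rewrite count_uniq_mem ?Ep.
case/forall_inPn=> E Ee new.
have [v [w [vp vw]]] := unused_at_vertex conn sym Ee new.
have [c [tc stuck]] := stuck_trail (residual e x p) v.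
(* The detour c from v is closed, as the residual degrees are all even. *)
have last_c : last v c = v.
  apply/eqP; have := odd_stuck (residual_sym x p sym) (residual_irr x p irr) tc stuck.
  by rewrite odd_residual // par addbb => /esym/negbFE.
have size_c : 0 < size c.
  by case: c tc stuck last_c => //= _ /(_ w vw).
have [p1 [p2 [def_p last_p1]]] : exists p1 p2, p = p1 ++ p2 /\ last x p1 = v.
  by case/splitPl: vp => p1 p2; exists p1, p2.
have perm_q : perm_eq (trail_edges x (p1 ++ c ++ p2)) (trail_edges x p ++ trail_edges v c).
  rewrite def_p !trail_edges_cat last_p1 last_c -catA perm_cat2l.
  by rewrite perm_catC.
have last_q : last x (p1 ++ c ++ p2) = last x p.
  by rewrite def_p !last_cat last_p1 last_c.
case/andP: tc => vc uc; case/andP: tp => xp up.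
have tq : trail e x (p1 ++ c ++ p2).
  apply/andP; split.
    have := xp; rewrite def_p !cat_path last_p1 last_c => /andP[-> ->] /=.
    by rewrite andbT (sub_path _ vc) // => a b /andP[].
  rewrite (perm_uniq perm_q) cat_uniq up uc andbT /=; apply/hasPn => E' /(trail_edges_sub vc).
  by rewrite edge_set_residual => /andP[].
have lt_q : #|edge_set e| - size (p1 ++ c ++ p2) < m.
  by have := trail_size tq; move: lt_m; rewrite def_p !size_cat; lia.
rewrite -last_q; apply: IHm lt_q tq _ => u.
by rewrite last_q.
Qed.

(** The parities on the right cover both classical cases: no odd vertex when
    a = b, and exactly the two odd vertices a and b otherwise. A stuck trail
    from a must stop at b, and is then completed by detours. *)
Lemma eulerian_trailP e : (forall u v, connect e u v) -> symmetric e -> irreflexive e ->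
  has_eulerian_trail e <->
  exists a b, forall v, odd #|incident e v| = (v == a) (+) (v == b).
Proof.
move=> conn sym irr; split=> [[x [p [tp all_p]]]|[a [b par]]].
  exists x, (last x p) => v; have /andP[xp _] := tp.
  rewrite -(odd_trail_incidence v irr xp) (count_incident v tp); congr (odd _).
  apply: eq_card => E; rewrite inE; case: (boolP (E \in incident e v)) => //=.
  by rewrite in_incident => /andP[/all_p cE _]; rewrite -has_pred1 has_count cE.
have [p [tp stuck]] := stuck_trail e a.
have last_p : last a p = b.
  have := odd_stuck sym irr tp stuck; rewrite par.
  by case: (_ =P b) => // _; case: eqP.
have [|q [eq_q _]] := eulerian_extension conn sym irr tp; last by exists a, q.
by move=> v; rewrite last_p.
Qed.

(** The trail of length 0 already has the right parities here, and detours do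
    not move the ends. *)
Lemma eulerian_even e x : (forall u v, connect e u v) -> symmetric e ->
  irreflexive e -> (forall v, ~~ odd #|incident e v|) -> eulerian e.
Proof.
move=> conn sym irr even.
have [|q [eq_q last_q]] := @eulerian_extension e x [::] conn sym irr isT.
  by move=> v; rewrite addbb; apply: negbTE.
by exists x, q.
Qed.

End Euler.

(** * Coefficients of power series *)

Local Open Scope ring_scope.

#[local] Arguments fps_coef : simpl never.

Section Series.
Context {R : comUnitRingType}.
Implicit Types u v w h : fps R.

Lemma fps_coefXM u k : [t^(k.+1)] (fps_X * u) = [t^k] u.
Proof.
rewrite fps_coefM 2!big_ord_recl !fps_coefX mul0r add0r mul1r big1 => [|i _].
  by rewrite addr0 /= subn1.
by rewrite fps_coefX mul0r.
Qed.

Lemma fps_coefXnM u m k : [t^(m + k)] (fps_X ^+ m * u) = [t^k] u.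
Proof. by elim: m => [|m IHm]; rewrite ?mul1r // exprS -mulrA fps_coefXM. Qed.

Lemma fps_coefMn u m k : [t^k] (u *+ m) = [t^k] u *+ m.
Proof. by elim: m => [|m IHm]; rewrite ?fps_coef0 // !mulrS fps_coefD IHm. Qed.

Lemma fps_coef_sum I (r : seq I) (P : pred I) (F : I -> fps R) k :
  [t^k] (\sum_(i <- r | P i) F i) = \sum_(i <- r | P i) [t^k] (F i).
Proof.
by elim/big_rec2: _ => [|i x y _ <-]; rewrite ?fps_coef0 ?fps_coefD.
Qed.

Lemma fps_coefM_exp_small u v m k : [t^0] v = 0 -> (k < m)%N -> [t^k] (u * v ^+ m) = 0.
Proof.
move=> v0 lt_km; rewrite fps_coefM big1 // => i _.
by rewrite fps_coef_exp_small ?mulr0 // (leq_ltn_trans (leq_subr _ _)).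
Qed.

Lemma fps_1B_unit u : [t^0] u = 0 -> 1 - u \is a GRing.unit.
Proof. by move=> u0; rewrite fps_unitE fps_coefB fps_coef1 u0 subr0 unitr1. Qed.

(** The terms of the geometric series from v^m on start in degree m. *)
Lemma fps_coef_geom u v k m : [t^0] v = 0 -> (k < m)%N ->
  [t^k] (u / (1 - v)) = \sum_(i < m) [t^k] (u * v ^+ i).
Proof.
move=> v0 lt_km; have v1 := fps_1B_unit v0.
have -> : u / (1 - v) = u * (\sum_(i < m) v ^+ i) + u / (1 - v) * v ^+ m.
  apply: (mulIr v1); rewrite mulrVK // mulrDl -!mulrA (mulrC _ (1 - v)).
  rewrite -[X in u * X]opprK -mulNr opprB -subrX1.
  by rewrite [v ^+ m * _]mulrC mulKr // -mulrDr opprB subrK mulr1.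
by rewrite fps_coefD (fps_coefM_exp_small _ v0 lt_km) addr0 mulr_sumr fps_coef_sum.
Qed.

Lemma fps_coef_compM F h w N : [t^0] h = 0 ->
  [t^N] (fps_comp F h * w) = \sum_(i < N.+1) [t^i] F * [t^N] (h ^+ i * w).
Proof.
move=> h0; under [RHS]eq_bigr do rewrite fps_coefM big_distrr /=.
rewrite exchange_big fps_coefM; apply: eq_bigr => a _ /=.
rewrite big_distrl /=.
under [RHS]eq_bigr do rewrite mulrA.
rewrite (big_ord_widen N.+1 (fun i => [t^i] F * [t^a] (h ^+ i) * [t^(N - a)] w)) //.
rewrite big_mkcond; apply: eq_bigr => i _.
by case: ltnP => // lt_ai; rewrite fps_coef_exp_small // mulr0 mul0r.
Qed.

(** The Euler operator t d/dt: it multiplies the coefficient of t^k by k with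
    no shift of the index, so that the Leibniz rule can be read off the
    coefficients. *)
Definition fps_theta u : fps R := fps_X * fps_deriv u.

Lemma fps_coef_theta u k : [t^k] (fps_theta u) = [t^k] u *+ k.
Proof. by case: k => [|k]; rewrite ?fps_coef0M ?fps_coefX ?mul0r // fps_coefXM. Qed.

Lemma fps_thetaM u v : fps_theta (u * v) = fps_theta u * v + u * fps_theta v.
Proof.
apply/fpsP => k; rewrite fps_coefD fps_coef_theta !fps_coefM -sumrMnl -big_split.
apply: eq_bigr => i _; rewrite !fps_coef_theta /= mulrnAl mulrnAr -mulrnDr.
by rewrite subnKC // -ltnS.
Qed.

Lemma fps_theta_exp u m : fps_theta (u ^+ m.+1) = (u ^+ m * fps_theta u) *+ m.+1.
Proof.
elim: m => [|m IHm]; first by rewrite mul1r.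
by rewrite exprS fps_thetaM IHm mulrnAr mulrA -exprS mulrC -mulrS.
Qed.

Lemma fps_theta_X : fps_theta fps_X = fps_X.
Proof.
apply/fpsP => k; rewrite fps_coef_theta !fps_coefX.
by case: k => [|[|k]]; rewrite ?mul0rn.
Qed.

End Series.

(** * Change of variable in residues *)

Section Residue.
Variable h : fps int.
Hypotheses (h0 : [t^0] h = 0) (h1 : [t^1] h \is a GRing.unit).

(** With w = t/h this is the residue of h^-(k+1) h' dt. For k > 0 the latter
    is a derivative up to the factor -k: in terms of t d/dt, the identity
    t = w h gives t w^(k+1) h' = t (w^k - w^(k-1) t w'), and the coefficients of
    t^k in k w^k and in t (w^k)' = k w^(k-1) t w' agree. Cancelling k uses that
    the integers have no torsion. *)
Lemma residue_power k :
  [t^k] (fps_Xdiv h ^+ k.+1 * fps_deriv h) = (k == 0%N)%:R.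
Proof.
have hw := fps_XdivK h0 h1; set w := fps_Xdiv h in hw *.
case: k => [|k].
  have := congr1 (fun u : fps int => [t^1] u) hw.
  rewrite fps_coef0M expr1 fps_coefM 2!big_ord_recl big_ord0 fps_coefX h0 mul0r add0r addr0.
  by rewrite mulrC.
have E : fps_X * (w ^+ k.+2 * fps_deriv h) = fps_X * (w ^+ k.+1 - w ^+ k * fps_theta w).
  have := fps_thetaM h w; rewrite hw fps_theta_X => Th.
  have Tw : w * fps_theta h = fps_X - h * fps_theta w by rewrite Th mulrC addrK.
  transitivity (w ^+ k.+1 * (w * fps_theta h)); first by rewrite /fps_theta exprSr; ring.
  rewrite Tw -hw exprSr; ring.
rewrite -fps_coefXM E fps_coefXM fps_coefB.
have := congr1 (fun u : fps int => [t^(k.+1)] u) (fps_theta_exp w k).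
rewrite fps_coef_theta fps_coefMn => /eqP; rewrite -subr_eq0 -mulrnBl.
by rewrite Num.Theory.mulrn_eq0 => /eqP.
Qed.

(** Substituting u = h(t) in the residue of F(u) u^-(N+1) du. The part of
    F(h) of order i contributes h^i (t/h)^(N+1) = t^i (t/h)^(N-i+1). *)
Lemma fps_change_variable F N :
  [t^N] (fps_comp F h * fps_Xdiv h ^+ N.+1 * fps_deriv h) = [t^N] F.
Proof.
have hw := fps_XdivK h0 h1; rewrite -mulrA fps_coef_compM //.
have powerE i : (i <= N)%N ->
    [t^N] (h ^+ i * (fps_Xdiv h ^+ N.+1 * fps_deriv h)) = (N - i == 0)%N%:R.
  move=> le_iN; rewrite -residue_power -(fps_coefXnM _ i (N - i)) subnKC // -hw exprMn.
  congr ([t^N] _).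
  by rewrite -[in LHS](subnKC (leqW le_iN)) exprD subSn // !mulrA.
rewrite big_ord_recr powerE //= subnn mulr1 big1 ?add0r // => i _.
by rewrite powerE 1?ltnW ?ltn_ord // subn_eq0 leqNgt ltn_ord mulr0.
Qed.

End Residue.

Lemma fps_comp_expr (R : comNzRingType) (u w : fps R) m : [t^0] w = 0 ->
  fps_comp (u ^+ m) w = fps_comp u w ^+ m.
Proof.
move=> w0; elim: m => [|m IHm]; first by rewrite !expr0 fps_comp1.
by rewrite !exprS fps_compM // IHm.
Qed.

Lemma fps_comp_divB (R : comUnitRingType) (u w : fps R) : [t^0] w = 0 ->
  fps_comp (u / (1 - fps_X)) w = fps_comp u w / (1 - w).
Proof.
move=> w0; have w1 := fps_1B_unit w0; apply: (mulIr w1); rewrite mulrVK //.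
have {1}-> : 1 - w = fps_comp (1 - fps_X) w by rewrite fps_compB fps_comp1 fps_compX.
rewrite -fps_compM // mulrVK //.
by apply: fps_1B_unit; rewrite fps_coefX.
Qed.

(** * Row and column sums of Riordan matrices *)

Section RiordanSums.
Variables (g f : fps int).
Hypotheses (f0 : [t^0] f = 0) (f1 : [t^1] f \is a GRing.unit).

Lemma riordan_row_sum x :
  [t^x] (fps_X * g / (1 - f)) = \sum_(y < x) [t^(x.-1)] (g * f ^+ y).
Proof.
rewrite -mulrA; case: x => [|x]; first by rewrite fps_coef0M fps_coefX mul0r big_ord0.
by rewrite fps_coefXM (fps_coef_geom _ f0 (ltnSn x)).
Qed.

(** For N = n - 2, the sum of the coefficients of g f^x up to degree N is
    [t^N] g f^x / (1 - t); the change of variable turns f^x into t^x, which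
    shifts the coefficient looked at from N to n - 2 - x. The additional
    factor t on the left covers the case n = 1, where N does not exist. *)
Lemma riordan_column_sum n x : (x < n)%N ->
  let h := fps_rev f in
  [t^(n - x.+1)] (fps_X * fps_comp g h * fps_deriv h * fps_Xdiv h ^+ (n - 1) / (1 - h))
    = \sum_(x.+1 <= z < n) [t^(z.-1)] (g * f ^+ x).
Proof.
move=> lt_xn h; have h0 : [t^0] h = 0 := fps_coef0_rev f.
have h1 : [t^1] h \is a GRing.unit by rewrite fps_coef1_rev // unitrV.
case: n lt_xn => // -[|N] lt_xn.
  case: x lt_xn => // _; rewrite subnn -!mulrA fps_coef0M fps_coefX mul0r.
  by rewrite big_geq.
rewrite subSS subn1 /= -(fps_coefXnM _ x) subnKC -1?ltnS //.
have -> : fps_X ^+ x * (fps_X * fps_comp g h * fps_deriv h * fps_Xdiv h ^+ N.+1 / (1 - h))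
    = fps_X * (fps_comp (g * f ^+ x / (1 - fps_X)) h * fps_Xdiv h ^+ N.+1 * fps_deriv h).
  rewrite fps_comp_divB // fps_compM // fps_comp_expr // fps_comp_rev //; ring.
rewrite fps_coefXM fps_change_variable // (@fps_coef_geom _ _ _ _ N.+1) ?fps_coefX //.
(* The sum may start at degree 0, as g f^x has order at least x. *)
have low0 : \sum_(0 <= z < x) [t^z] (g * f ^+ x) = 0.
  rewrite big_nat_cond big1 // => z /andP[/andP[_ lt_zx] _].
  by rewrite fps_coefM_exp_small.
rewrite big_add1 /=; transitivity (\sum_(0 <= z < N.+1) [t^z] (g * f ^+ x)); last first.
  by rewrite (big_cat_nat (leq0n x)) //= low0 add0r.
rewrite big_mkord (reindex_inj rev_ord_inj); apply: eq_bigr => z _ /=.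
by rewrite subSS mulrC -(fps_coefXnM _ (N - z) z) subnK // leq_ord.
Qed.
End RiordanSums.

(** * Degrees and connectedness of Riordan graphs *)

Lemma modz2_sum_odd I (r : seq I) (F : I -> int) :
  (\sum_(i <- r) F i = (\sum_(i <- r) (F i == 1 %[mod 2])%Z)%N%:Z %[mod 2])%Z.
Proof.
elim: r => [|i r IHr]; first by rewrite !big_nil.
by rewrite !big_cons; move: IHr; case: eqP => /= ?; rewrite PoszD; lia.
Qed.

Section Degrees.
Variables (n : nat) (g f : fps int).
Hypotheses (f0 : [t^0] f = 0) (f1 : [t^1] f \is a GRing.unit).

(** Below the diagonal, the adjacency matrix is the Riordan matrix modulo 2;
    by symmetry, the neighbours of x are the odd entries of the row of x left
    of the diagonal and of the column of x below it. *)
Lemma riordan_degree (x : 'I_n) :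
  ((\sum_(y < n) riordan_graph n g f x y)%N%:Z
    = [t^x] (fps_X * g / (1 - f)) +
      [t^(n - x.+1)] (fps_X * fps_comp g (fps_rev f) * fps_deriv (fps_rev f)
                       * fps_Xdiv (fps_rev f) ^+ (n - 1) / (1 - fps_rev f)) %[mod 2])%Z.
Proof.
rewrite riordan_row_sum // riordan_column_sum //.
pose F (y : nat) : bool := if (y < x)%N then riordan_entry g f x.+1 y.+1
  else (x < y)%N && riordan_entry g f y.+1 x.+1.
have -> : (\sum_(y < n) riordan_graph n g f x y)%N = (\sum_(0 <= y < n) F y)%N.
  by rewrite big_mkord.
rewrite (big_cat_nat (leq0n x)) 1?ltnW //= [X in (_ + X)%N]big_ltn // {2}/F ltnn add0n.
rewrite -(big_mkord xpredT (fun y => [t^(x.-1)] (g * f ^+ y))).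
rewrite -modzDm !modz2_sum_odd modzDm -PoszD; congr ((Posz (_ + _)) %% _)%Z.
  rewrite big_nat [RHS]big_nat; apply: eq_bigr => y /andP[_ lt_yx].
  by rewrite /F lt_yx /riordan_entry subSS !subn1.
rewrite big_nat [RHS]big_nat; apply: eq_bigr => y /andP[lt_xy _].
by rewrite /F ltnNge ltnW //= lt_xy /riordan_entry subSS !subn1.
Qed.

End Degrees.

Lemma fps_coef_diag (R : comUnitRingType) (u v : fps R) m : [t^0] v = 0 ->
  [t^m] (u * v ^+ m) = [t^0] u * ([t^1] v) ^+ m.
Proof.
move=> v0; have -> : u * v ^+ m = fps_X ^+ m * (u * fps_divX v ^+ m).
  by rewrite mulrCA -exprMn fps_divXK.
rewrite -[X in [t^X] (_ * _)]addn0 fps_coefXnM fps_coef0M; congr (_ * _).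
by elim: m => [|m IHm]; rewrite ?fps_coef1 // !exprS fps_coef0M IHm.
Qed.

(** The diagonal coefficient [t^x] g f^x is g(0) f'(0)^x, which is odd: the
    vertices form a path in their natural order. *)
Lemma riordan_connected n g f : [t^0] f = 0 -> [t^1] f = 1 -> ([t^0] g = 1 %[mod 2])%Z ->
  forall x y, connect (riordan_graph n g f) x y.
Proof.
move=> f0 f1 g0.
have step (x y : 'I_n) : y = x.+1 :> nat -> riordan_graph n g f x y.
  move=> eq_yx; rewrite /riordan_graph eq_yx ltnNge leqnSn ltnSn /=.
  by rewrite /riordan_entry subSS !subn1 /= fps_coef_diag // f1 expr1n mulr1 g0.
have up d (x y : 'I_n) : y = (x + d)%N :> nat -> connect (riordan_graph n g f) x y.
  elim: d y => [|d IHd] y eq_y.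
    by rewrite (_ : y = x) //; apply: val_inj; rewrite /= eq_y addn0.
  have lt_z : (x + d < n)%N by apply: leq_trans (ltn_ord y); rewrite eq_y addnS.
  apply: connect_trans (IHd (Ordinal lt_z) erefl) (connect1 _).
  by apply: step; rewrite eq_y addnS.
move=> x y; case: (leqP x y) => [le_xy|/ltnW le_yx].
  by apply: (up (y - x)%N); rewrite subnKC.
rewrite (sym_connect_sym (@riordan_graph_sym n g f)).
by apply: (up (x - y)%N); rewrite subnKC.
Qed.

(** * Euler's criterion for Riordan graphs *)

Theorem corollary3p18 (n : nat) (g f : fps int) (phi vphi : nat -> int) :
  (1 <= n)%N ->
  [t^0] f = 0 ->
  riordan_proper g f ->
  [t^0] (fps_deriv f) = 1 ->
  let fbar := fps_rev f in
  (forall j : nat, (j < n)%N ->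
    (phi j = [t^j] (fps_X * g / (1 - f)) %[mod 2])%Z) ->
  (forall j : nat, (j < n)%N ->
    (vphi j = [t^j] (fps_X * fps_comp g fbar * fps_deriv fbar
                       * fps_Xdiv fbar ^+ (n - 1) / (1 - fbar)) %[mod 2])%Z) ->
  let G := riordan_graph n g f in
  let star := forall i : nat, (1 <= i <= n)%N ->
    (phi (i - 1)%N + vphi (n - i)%N = 0 %[mod 2])%Z in
  (has_eulerian_trail G <->
     star \/
     exists i1 i2 : nat,
       [/\ (1 <= i1 <= n)%N, (1 <= i2 <= n)%N, i1 <> i2 &
           forall i : nat, (1 <= i <= n)%N ->
             (phi (i - 1)%N + vphi (n - i)%N
                = (if (i == i1) || (i == i2) then 1 else 0) %[mod 2])%Z])
  /\ (star -> eulerian G).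
Proof.
move=> n_gt0 f0 [g0 _] f1 fbar phiE vphiE G star.
have {}f1 : [t^1] f = 1 by [].
have conn : forall x y, connect G x y by apply: riordan_connected.
have sym : symmetric G := @riordan_graph_sym n g f.
have irr : irreflexive G := @riordan_graph_irr n g f.
have parity (x : 'I_n) :
    (phi (x.+1 - 1)%N + vphi (n - x.+1)%N = odd #|incident G x| %[mod 2])%Z.
  have f1U : [t^1] f \is a GRing.unit by rewrite f1 unitr1.
  rewrite subn1 /= -modzDm phiE // vphiE ?ltn_subrL // modzDm.
  by rewrite -riordan_degree // -card_incident //; lia.
have starP : star <-> forall v, ~~ odd #|incident G v|.
  split=> [all0 v|even i].
    have := all0 v.+1 (ltn_ord v); rewrite parity; lia.
  case: i => // i lt_in; have := parity (Ordinal lt_in).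
  by have := even (Ordinal lt_in); case: odd.
have circuit : star -> eulerian G.
  by move=> /starP; apply: eulerian_even conn sym irr; exact: Ordinal n_gt0.
split=> //; rewrite eulerian_trailP //; split=> [[a [b par]]|].
  have [eq_ab|ne_ab] := eqVneq a b.
    by left; apply/starP => v; rewrite par eq_ab addbb.
  right; exists a.+1, b.+1; split; rewrite ?ltn_ord //.
    by move=> [eq_ab]; case/eqP: ne_ab; apply: val_inj.
  case=> // i lt_in; have -> := parity (Ordinal lt_in); rewrite par !eqSS.
  rewrite -[_ == a]val_eqE -[_ == b]val_eqE /=.
  have : ~~ ((i == a) && (i == b)).
    by apply: contra ne_ab => /andP[/eqP i_a /eqP i_b]; rewrite -val_eqE /= -i_a i_b.
  by case: (i == a); case: (i == b).
case=> [/starP even|[[|i1] [[|i2] [//lt_i1 lt_i2 ne_i par]]]].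
  by exists (Ordinal n_gt0), (Ordinal n_gt0) => v; rewrite addbb; apply: negbTE.
exists (Ordinal lt_i1), (Ordinal lt_i2) => v.
have := par v.+1 (ltn_ord v); rewrite parity !eqSS -!val_eqE /=.
case: eqP => [->|_]; case: eqP => [eq_i|_]; try by case: odd.
by case: ne_i; rewrite eq_i.
Qed.
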